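(* Let $n\geq 2$, and let $f(n)$ be the maximal value of $\mathrm{ls}(w)$ over all $w\in\mathfrak{B}_n\setminus\mathcal{S}_n$, where $\mathrm{ls}(w)$ denotes the smallest $m\ge 1$ such that $w$ is a product of $m$ (not necessarily distinct) elements of the generating set $\{\sigma_{i,j}: i,j\in\{1,\dots,n\},\ i\neq j\}$. Then $$f(n)=\left\lfloor\frac{3n}{2}\right\rfloor-2.$$
   Context: Put $\mathbf{n}=\{1,\dots,n\}$ and $\mathbf{n}'=\{1',\dots,n'\}$ (a disjoint copy). The Brauer semigroup $\mathfrak{B}_n$ is the set of all partitions of $\mathbf{n}\cup\mathbf{n}'$ into two-element blocks. The product $\pi\tau$ is defined by concatenation: identify each $x'$ of $\pi$ with the element $x$ of $\tau$, take the graph whose edges are the blocks of $\pi$ and of $\tau$, and let two of the remaining $2n$ outer points (the unprimed points of $\pi$ and the primed points of $\tau$) be in the same block of $\pi\tau$ iff they are joined by a path in this graph (closed loops in the middle are discarded). $\mathcal{S}_n\subset\mathfrak{B}_n$ is the group of invertible elements, i.e. the elements all of whose blocks have the form $\{i,j'\}$; $\mathfrak{B}_n\setminus\mathcal{S}_n$ is the subsemigroup of non-invertible elements. For $i\neq j$ in $\mathbf{n}$, $\sigma_{i,j}=\{\{i,j\},\{i',j'\},\{k,k'\}_{k\neq i,j}\}$. It is known that the elements $\sigma_{i,j}$ generate the semigroup $\mathfrak{B}_n\setminus\mathcal{S}_n$. *)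

(* Defs.v *)
From HB Require Import structures.
From mathcomp Require Import all_boot zify.

Set Implicit Arguments.
Unset Strict Implicit.
Unset Printing Implicit Defensive.

Section Pairings.
Variable T : finType.

Definition is_pairing (P : {set {set T}}) : bool :=
  partition P [set: T] && [forall B in P, #|B| == 2].

Lemma pairing_of_involution (m : T -> T) :
  involutive m -> (forall p, m p != p) ->
  is_pairing [set [set p; m p] | p : T].
Proof.
move=> mK mN; apply/andP; split; last first.
  apply/forall_inP => _ /imsetP [p _ ->].
  by rewrite cards2 [p == _]eq_sym mN.
apply/and3P; split.
- rewrite eqEsubset subsetT; apply/subsetP => /= p _.
  by apply/bigcupP; exists [set p; m p]; [apply: imset_f|rewrite set21].
- apply/trivIsetP => _ _ /imsetP [p _ ->] /imsetP [q _ ->] npq.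
  rewrite -setI_eq0; apply/eqP/setP => z; rewrite !inE.
  apply/negbTE; apply: contra npq => /andP [zp zq]; apply/eqP.
  suff E (r : T) : (z == r) || (z == m r) -> [set r; m r] = [set z; m z].
    by rewrite (E p) ?(E q).
  by case/orP => /eqP ->; rewrite ?mK // setUC.
- apply/imsetP => -[p _ /setP /(_ p)].
  by rewrite !inE eqxx.
Qed.

Lemma pairing_mate (P : {set {set T}}) : is_pairing P ->
  exists2 m : T -> T, involutive m &
    (forall p, m p != p) /\ P = [set [set p; m p] | p : T].
Proof.
case/andP => /and3P [/eqP cP tP _] /forall_inP c2.
have ex p : exists q, (q != p) && ([set p; q] \in P).
  have : p \in cover P by rewrite cP inE.
  case/bigcupP => B BP; have /cards2P [a [b [ab EB]]] := c2 B BP.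
  rewrite EB in BP *; rewrite !inE => /orP [] /eqP ->.
    by exists b; rewrite BP eq_sym ab.
  by exists a; rewrite setUC BP ab.
pose m p := xchoose (ex p).
have mN p : m p != p by case/andP: (xchooseP (ex p)).
have mP p : [set p; m p] \in P by case/andP: (xchooseP (ex p)).
have mE p B : B \in P -> p \in B -> B = [set p; m p].
  move=> BP pB; rewrite -(def_pblock tP BP pB).
  by rewrite (def_pblock tP (mP p)) ?set21.
exists m; last split=> //.
  move=> p; have := mE (m p) _ (mP p) (set22 _ _).
  move/setP/(_ p); rewrite !inE eqxx /= => /esym /orP [] /eqP E.
    by have := mN p; rewrite -E eqxx.
  by rewrite -E.
apply/setP => B; apply/idP/imsetP => [BP|[p _ ->] //].
have /cards2P [a [b [ab EB]]] := c2 B BP.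
by exists a => //; apply: mE => //; rewrite EB set21.
Qed.

End Pairings.

(* A dihedral orbit that meets the fixed points of its two generators meets
   them exactly twice.  [step] walks along the orbit applying the generators
   alternately, the boolean telling which one comes next. *)
Section Dihedral.
Variables (T : finType) (a b : T -> T).
Hypotheses (aK : involutive a) (bK : involutive b).
Hypothesis abN : forall v, ~~ ((a v == v) && (b v == v)).

Let e : rel T := fun u v => (v == a u) || (v == b u).
Let step (z : T * bool) := (if z.2 then a z.1 else b z.1, ~~ z.2).
Let flip (z : T * bool) := (z.1, ~~ z.2).

Let stepI : injective step.
Proof.
move=> [u c] [v d] [E] /(congr1 negb); rewrite !negbK => cd; subst d.
by case: c E => [/(inv_inj aK)|/(inv_inj bK)] ->.
Qed.

Let stepflip z : step (flip (step z)) = flip z.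
Proof. by case: z => v []; rewrite /step /flip /= ?aK ?bK. Qed.

Let flip_orbit k z : iter k step (flip (iter k step z)) = flip z.
Proof.
elim: k z => //= k IH z.
by rewrite -iterS iterSr stepflip IH.
Qed.

Let flipN z : flip z != z.
Proof. by case: z => v []; apply/eqP. Qed.

Lemma dihedral_card2_a x : a x = x ->
  #|[set v | connect e x v && ((a v == v) || (b v == v))]| = 2.
Proof.
move=> ax; set y := (x, true); set N := order step y.
have sy : step y = flip y by rewrite /step /flip /= ax.
have N0 : 0 < N by apply: order_gt0.
have iterN k : iter (k + N) step y = iter k step y.
  by rewrite iterD (iter_order stepI).
have iterI k l : k < N -> l < N -> iter k step y = iter l step y -> k = l.
  move=> kN lN E; rewrite -(findex_iter kN) -(findex_iter lN).
  by rewrite E.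
have oP z : fconnect step y z -> exists2 k, k < N & z = iter k step y.
  move=> yz; exists (findex step y z); first exact: findex_max.
  by rewrite iter_findex.
have flipO z : fconnect step y z -> fconnect step y (flip z).
  move=> yz; case/oP: (yz) => k _ Ez.
  rewrite fconnect_sym //; apply: connect_trans (fconnect_iter _ k _) _.
  rewrite {1}Ez flip_orbit -sy fconnect_sym //; exact: fconnect1.
have connP v : connect e x v -> forall c, fconnect step y (v, c).
  move=> /connectP [p]; elim/last_ind: p v => [|p u IH] v.
    move=> _ -> [] //; exact: (flipO y).
  rewrite rcons_path last_rcons => /andP [pp eu] -> c.
  have {IH} I := IH _ pp erefl.
  suff: fconnect step y (u, ~~ c) \/ fconnect step y (u, c).
    by case=> // /flipO; rewrite /flip /= negbK.
  case/orP: eu => /eqP ->.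
    have := connect_trans (I true) (fconnect1 step _); rewrite /step /=.
    by case: c; [left|right].
  have := connect_trans (I false) (fconnect1 step _); rewrite /step /=.
  by case: c; [right|left].
have connR z : fconnect step y z -> connect e x z.1.
  case/oP => k _ ->; elim: k => [|k IH] /=; first exact: connect0.
  apply: connect_trans IH (connect1 _).
  by rewrite /e; case: (iter k step y).2; rewrite eqxx ?orbT.
have fixE k : k < N -> step (iter k step y) = flip (iter k step y) ->
    k.*2 = 0 \/ k.*2 = N.
  move=> kN E; have := flip_orbit k y; rewrite -E -sy -iterS -iterD.
  rewrite addnS addnn iterS => /stepI E2.
  case: (ltnP k.*2 N) => H; first by left; apply: iterI.
  right; have := iterN (k.*2 - N); rewrite subnK // E2 => E3.
  suff : 0 = k.*2 - N by lia.
  by apply: iterI => //; lia.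
have Neven : ~~ odd N.
  apply/negP => oN; have := flip_orbit N./2.+1 y; rewrite -sy.
  set z := iter N./2.+1 step y => E.
  suff /eqP : flip z = z by rewrite (negbTE (flipN z)).
  have H : iter N./2.+1 step z = step y.
    rewrite /z -iterD (_ : _ + _ = 1 + N) ?iterN //.
    by have := odd_double_half N; rewrite oN; lia.
  have iI : injective (iter N./2.+1 step).
    by elim: (N./2.+1) => [|k IH] u v //= /stepI /IH.
  by apply: iI; rewrite E H.
have halfN : N./2.*2 = N by rewrite -[RHS]odd_double_half (negbTE Neven).
have hN : N./2 < N by lia.
set z := iter N./2 step y.
have yz : fconnect step y z by exact: fconnect_iter.
have sz : step z = flip z.
  have iI : injective (iter N./2 step).
    by elim: (N./2) => [|k IH] u v //= /stepI /IH.
  apply: iI; rewrite flip_orbit -sy /z -iterSr -iterD addSn addnn.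
  by rewrite halfN -[N.+1]/(1 + N) iterN.
have zy : z != y.
  apply/eqP => /(iterI N./2 0 hN N0); lia.
have fixP v c : step (v, c) = flip (v, c) <-> (if c then a v else b v) = v.
  by rewrite /step /flip /=; split=> [[]|->].
have zx : x != z.1.
  apply/eqP => xz; move: zy sz; rewrite (surjective_pairing z) -xz /y.
  case: z.2; first by rewrite eqxx.
  move=> _ /fixP bx; have := abN x; by rewrite ax bx eqxx.
rewrite (_ : [set v | _] = [set x; z.1]) ?cards2 ?zx //.
apply/setP => v; rewrite !inE; apply/andP/orP.
  case=> /connP O fv.
  have [c fc] : exists c, step (v, c) = flip (v, c).
    case/orP: fv => /eqP fv; [exists true|exists false]; exact/fixP.
  have [k kN Ek] := oP _ (O c); rewrite Ek in fc.
  case: (fixE _ kN fc) => k2.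
    have k0 : k = 0 by lia.
    by left; move: Ek; rewrite k0 => -[->].
  have k0 : k = N./2 by lia.
  by right; move: Ek; rewrite k0 -/z => <-.
case=> /eqP ->; first by rewrite connect0 ax eqxx.
split; first exact: connR.
move: sz; rewrite (surjective_pairing z); case: z.2 => /fixP -> /=;
  by rewrite eqxx ?orbT.
Qed.

End Dihedral.

Lemma dihedral_card2 (T : finType) (a b : T -> T) x :
  involutive a -> involutive b ->
  (forall v, ~~ ((a v == v) && (b v == v))) ->
  (a x == x) || (b x == x) ->
  #|[set v | connect (fun u v => (v == a u) || (v == b u)) x v
             && ((a v == v) || (b v == v))]| = 2.
Proof.
move=> aK bK abN /orP [] /eqP fx; first exact: dihedral_card2_a.
rewrite -(@dihedral_card2_a T b a bK aK _ x fx); last by move=> v; rewrite andbC.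
apply: eq_card => v; rewrite !inE orbC; congr andb.
by apply: eq_connect => s t; rewrite orbC.
Qed.

Section Brauer.
Variable n : nat.

(* inl i stands for i and inr i for i' *)
Definition point : finType := ('I_n + 'I_n)%type.

Record brauer := Brauer {
  blocks :> {set {set point}};
  blocksP : is_pairing blocks
}.

HB.instance Definition _ := [isSub for blocks].
HB.instance Definition _ := [Finite of brauer by <:].

(* The points of the concatenation of x and y: inl (inl i) is the point i of x,
   inl (inr i) is the point i' of x identified with the point i of y, and inr i
   is the point i' of y. *)
Definition cpoint : finType := (('I_n + 'I_n) + 'I_n)%type.

Definition of_left (p : point) : cpoint := inl p.

Definition of_right (p : point) : cpoint :=
  match p with inl i => inl (inr i) | inr i => inr i end.

Definition outer (p : point) : cpoint :=
  match p with inl i => inl (inl i) | inr i => inr i end.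

Definition cedge (x y : brauer) : rel cpoint := fun u v =>
  ([set u; v] \in [set of_left @: B | B : {set point} in blocks x]) ||
  ([set u; v] \in [set of_right @: B | B : {set point} in blocks y]).

Definition mul_blocks (x y : brauer) : {set {set point}} :=
  equivalence_partition
    (fun p q => connect (cedge x y) (outer p) (outer q)) [set: point].

Lemma mul_blocks_pairing x y : is_pairing (mul_blocks x y).
Proof.
have [mx mxK [mxN Ex]] := pairing_mate (blocksP x).
have [my myK [myN Ey]] := pairing_mate (blocksP y).
pose a (v : cpoint) : cpoint :=
  if v is inl p then of_left (mx p) else v.
pose b (v : cpoint) : cpoint := match v with
  | inl (inl i) => v
  | inl (inr i) => of_right (my (inl i))
  | inr i => of_right (my (inr i)) end.
have bR p : b (of_right p) = of_right (my p) by case: p.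
have RI : injective of_right by move=> [i|i] [j|j] //= [->].
have LI : injective of_left by move=> p q [].
have aK : involutive a by move=> [p|i] //=; rewrite mxK.
have bK : involutive b.
  by move=> [[i|i]|i]; rewrite //= bR myK.
have aN v : (a v == v) = if v is inl _ then false else true.
  by case: v => [p|i] /=; rewrite ?eqxx // (inj_eq LI) (negbTE (mxN _)).
have bN v : (b v == v) = if v is inl (inl _) then true else false.
  case: v => [[i|i]|i] /=; rewrite ?eqxx //.
    by rewrite -(negbTE (myN (inl i))) -(inj_eq RI).
  by rewrite -(negbTE (myN (inr i))) -(inj_eq RI).
have abN v : ~~ ((a v == v) && (b v == v)) by rewrite aN bN; case: v => [[]|].
have fixE v : (a v == v) || (b v == v) = [exists p, v == outer p].
  rewrite aN bN; apply/idP/existsP => [|[[i|i] /eqP ->]] //.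
  by case: v => [[i|i]|i] // _; [exists (inl i)|exists (inr i)].
have oI : injective outer by move=> [i|i] [j|j] //= [->].
have setE (u v s t : cpoint) : [set u; v] = [set s; t] ->
    (u = s /\ v = t) \/ (u = t /\ v = s) .
  move=> /setP E; have := E u; have := E v; have := E s; have := E t.
  rewrite !inE !eqxx !orbT /= => /orP [] /eqP -> /orP [] /eqP -> /esym;
    by case/orP => /eqP E1 /esym /orP [] /eqP E2; subst; auto.
have eE u v : cedge x y u v = (u != v) && ((v == a u) || (v == b u)).
  rewrite /cedge Ex Ey; apply/orP/andP.
    case=> /imsetP [_ /imsetP [p _ ->]]; rewrite imsetU1 imset_set1 => /setE.
      have pN : of_left (mx p) != of_left p by rewrite (inj_eq LI).
      by case=> -[-> ->] /=; rewrite ?mxK ?eqxx ?pN // eq_sym pN.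
    have pN : of_right (my p) != of_right p by rewrite (inj_eq RI).
    by case=> -[-> ->] /=; rewrite ?bR ?myK ?eqxx ?orbT ?pN // eq_sym pN.
  case=> uv /orP [] /eqP E; [left|right].
    case: u E uv => [p|i] /= ->; last by rewrite eqxx.
    move=> _; apply/imsetP; exists [set p; mx p]; first exact: imset_f.
    by rewrite imsetU1 imset_set1.
  have [p Ep] : exists p, u = of_right p.
    case: u E uv => [[i|i]|i] /= ->; first by rewrite eqxx.
      by exists (inl i).
    by exists (inr i).
  apply/imsetP; exists [set p; my p]; first exact: imset_f.
  by rewrite imsetU1 imset_set1 E Ep bR.
pose e u v := (v == a u) || (v == b u).
have cE : connect (cedge x y) =2 connect e.
  move=> u v; apply/idP/idP; apply: connect_sub => s t.
    by rewrite eE => /andP [_ H]; apply: connect1.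
  case: (eqVneq s t) => [-> _|st H]; first exact: connect0.
  by apply: connect1; rewrite eE st.
have eS : symmetric e.
  move=> u v; rewrite /e [v == a u]eq_sym [v == b u]eq_sym.
  by rewrite (can2_eq aK aK) (can2_eq bK bK).
have cS := sym_connect_sym eS.
have eqv : {in [set: point] & &, equivalence_rel
    (fun p q => connect (cedge x y) (outer p) (outer q))}.
  move=> p q r _ _ _; rewrite !cE; split; first exact: connect0.
  by move=> H; apply: (same_connect cS).
rewrite /is_pairing equivalence_partitionP //=; apply/forall_inP.
move=> _ /imsetP [p _ ->].
have fp : (a (outer p) == outer p) || (b (outer p) == outer p).
  by rewrite fixE; apply/existsP; exists p.
rewrite -(dihedral_card2 aK bK abN fp).
rewrite -(card_imset _ oI); apply/eqP/eq_card => v; rewrite !inE fixE.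
apply/imsetP/andP => [[q]|[cv /existsP [q /eqP Eq]]].
  rewrite !inE cE => H ->; split=> //; by apply/existsP; exists q.
by exists q => //; rewrite !inE cE -Eq.
Qed.

Definition brauer_mul x y : brauer := Brauer (mul_blocks_pairing x y).

Definition one_blocks : {set {set point}} :=
  [set [set (inl i : point); inr i] | i : 'I_n].

Lemma one_blocks_pairing : is_pairing one_blocks.
Proof.
pose m (p : point) : point := match p with inl i => inr i | inr i => inl i end.
rewrite (_ : one_blocks = [set [set p; m p] | p : point]).
  by apply: pairing_of_involution => [] [i|i].
apply/setP => B; apply/imsetP/imsetP => [[i _ ->]|[[i|i] _ ->]].
- by exists (inl i).
- by exists i.
- by exists i => //=; rewrite setUC.
Qed.

Definition brauer_one : brauer := Brauer one_blocks_pairing.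

Definition invertible (x : brauer) : bool :=
  [exists y, (brauer_mul x y == brauer_one) && (brauer_mul y x == brauer_one)].

Lemma pairing_sub_eq (T : finType) (P Q : {set {set T}}) :
  is_pairing P -> is_pairing Q -> P \subset Q -> P = Q.
Proof.
case/andP => /and3P [/eqP cP _ _] _ /andP [/and3P [_ tQ Q0] _] PQ.
apply/eqP; rewrite eqEsubset PQ; apply/subsetP => B BQ.
have /set0Pn [p pB] : B != set0 by apply: contraNneq Q0 => <-.
have : p \in cover P by rewrite cP inE.
case/bigcupP => C CP pC; rewrite -(def_pblock tQ BQ pB).
by rewrite (def_pblock tQ (subsetP PQ _ CP) pC).
Qed.

Lemma mul_joined (x y : brauer) p q :
  p != q -> connect (cedge x y) (outer p) (outer q) ->
  [set p; q] \in mul_blocks x y.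
Proof.
move=> pq cpq; have /andP [_ /forall_inP c2] := mul_blocks_pairing x y.
set R := fun p q => connect (cedge x y) (outer p) (outer q).
have BM : [set r in [set: point] | R p r] \in mul_blocks x y by exact: imset_f.
suff -> : [set p; q] = [set r in [set: point] | R p r] by [].
apply/eqP; rewrite eqEcard (eqP (c2 _ BM)) cards2 pq andbT.
by apply/subsetP => r; rewrite !inE => /orP [] /eqP -> //; apply: connect0.
Qed.

Let swap (p : point) : point :=
  match p with inl i => inr i | inr i => inl i end.

Let swapK : involutive swap. Proof. by case. Qed.

Let swap_pairing (x : brauer) :
  is_pairing [set swap @: B | B : {set point} in blocks x].
Proof.
have [m mK [mN ->]] := pairing_mate (blocksP x).
have -> : [set swap @: B | B : {set point} in [set [set p; m p] | p : point]]
    = [set [set p; swap (m (swap p))] | p : point].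
  apply/setP => B; apply/imsetP/imsetP => [[_ /imsetP [p _ ->] ->]|[p _ ->]].
    by exists (swap p); rewrite // imsetU1 imset_set1 swapK.
  exists [set swap p; m (swap p)]; first exact: imset_f.
  by rewrite imsetU1 imset_set1 swapK.
apply: pairing_of_involution => p; first by rewrite swapK mK swapK.
by rewrite -(inj_eq (inv_inj swapK)) swapK.
Qed.

Let transversal (x : brauer) :=
  forall B, B \in blocks x -> exists i j, B = [set (inl i : point); inr j].

Let swap_mul (x y : brauer) : transversal x ->
  blocks y = [set swap @: B | B : {set point} in blocks x] ->
  brauer_mul x y = brauer_one.
Proof.
move=> tx Ey; apply/esym/val_inj; apply: pairing_sub_eq;
  [exact: one_blocks_pairing|exact: mul_blocks_pairing|].
apply/subsetP => _ /imsetP [i _ ->]; apply: mul_joined => //.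
have /andP [/and3P [/eqP cx _ _] _] := blocksP x.
have : (inl i : point) \in cover x by rewrite cx inE.
case/bigcupP => B Bx; have [k [j EB]] := tx B Bx.
rewrite EB !inE orbF => /eqP [ik]; rewrite {}EB -{k}ik in Bx.
apply: (@connect_trans _ _ (inl (inr j))); apply: connect1; apply/orP.
  left; apply/imsetP; exists [set (inl i : point); inr j] => //.
  by rewrite imsetU1 imset_set1.
right; apply/imsetP; exists [set (inl j : point); inr i].
  rewrite Ey; apply/imsetP; exists [set (inl i : point); inr j] => //.
  by rewrite imsetU1 imset_set1 setUC.
by rewrite imsetU1 imset_set1.
Qed.

Lemma invertibleP (x : brauer) :
  reflect (forall B, B \in blocks x ->
             exists i j, B = [set (inl i : point); inr j])
          (invertible x).
Proof.
apply: (iffP existsP) => [[y /andP [/eqP xy /eqP yx]] B Bx|tx].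
  have /andP [_ /forall_inP c2] := blocksP x.
  have /cards2P [p [q [pq EB]]] := c2 B Bx; rewrite EB in Bx *.
  have oneE : [set p; q] \in one_blocks ->
      forall i j, [set p; q] <> [set (inl i : point); inl j] /\
                  [set p; q] <> [set (inr i : point); inr j].
    case/imsetP => k _ -> i j; split => /setP E.
      by have := E (inr k); rewrite !inE eqxx ?orbT.
    by have := E (inl k); rewrite !inE eqxx ?orbT.
  case: p q pq Bx {EB c2} oneE => [i|i] [j|j] pq Bx oneE.
  - have [] := oneE _ i j; last by [].
    rewrite -[one_blocks]/(blocks brauer_one) -xy; apply: mul_joined => //.
    apply: connect1; apply/orP; left; apply/imsetP.
    by exists [set (inl i : point); inl j] => //; rewrite imsetU1 imset_set1.
  - by exists i, j.
  - by exists j, i; rewrite setUC.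
  - have [] := oneE _ i j; last by [].
    rewrite -[one_blocks]/(blocks brauer_one) -yx; apply: mul_joined => //.
    apply: connect1; apply/orP; right; apply/imsetP.
    by exists [set (inr i : point); inr j] => //; rewrite imsetU1 imset_set1.
pose y := Brauer (swap_pairing x); exists y.
rewrite (swap_mul tx (erefl : blocks y = _)) eqxx /=; apply/eqP.
apply: swap_mul => [_ /imsetP [B Bx ->]|].
  have [i [j ->]] := tx B Bx; exists j, i.
  by rewrite imsetU1 imset_set1 setUC.
rewrite /= -imset_comp -[LHS]imset_id; apply: eq_imset => B /=.
by rewrite -imset_comp -[LHS]imset_id; apply: eq_imset => p /=; rewrite swapK.
Qed.

Definition sigma_blocks (i j : 'I_n) : {set {set point}} :=
  [set [set (inl i : point); inl j]; [set (inr i : point); inr j]]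
  :|: [set [set (inl k : point); inr k] | k : 'I_n in ~: [set i; j]].

Lemma sigma_blocks_pairing i j : i != j -> is_pairing (sigma_blocks i j).
Proof.
move=> ij; have ji : (j == i) = false by rewrite eq_sym; apply: negbTE.
have {}ij := negbTE ij.
pose m (p : point) : point := match p with
  | inl k => if k == i then inl j else if k == j then inl i else inr k
  | inr k => if k == i then inr j else if k == j then inr i else inl k
  end.
have -> : sigma_blocks i j = [set [set p; m p] | p : point].
  apply/setP => B; apply/idP/imsetP.
    rewrite !inE => /orP [/orP [] /eqP ->|/imsetP [k]].
    - by exists (inl i); rewrite //= eqxx.
    - by exists (inr i); rewrite //= eqxx.
    - rewrite !inE negb_or => /andP [ki kj] ->.
      by exists (inl k); rewrite //= (negbTE ki) (negbTE kj).
  case=> -[k|k] _ -> /=; rewrite !inE;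
    case: (eqVneq k i) => [->|ki]; try (by rewrite eqxx ?orbT);
    case: (eqVneq k j) => [->|kj];
    try (by rewrite [[set _ j; _ i]]setUC eqxx ?orbT);
    apply/orP; right; apply/imsetP; exists k;
    rewrite ?inE ?negb_or ?ki ?kj //.
  by rewrite setUC.
have LE (k l : 'I_n) : ((inl k : point) == inl l) = (k == l) by [].
have RE (k l : 'I_n) : ((inr k : point) == inr l) = (k == l) by [].
apply: pairing_of_involution => -[k|k] /=;
  case: (eqVneq k i) => [->|ki] /=; rewrite ?eqxx ?LE ?RE ?ji //;
  case: (eqVneq k j) => [->|kj] /=;
  rewrite ?eqxx ?LE ?RE ?ij ?ji ?(negbTE ki) ?(negbTE kj) //.
Qed.

Definition sigma i j (ij : i != j) : brauer := Brauer (sigma_blocks_pairing ij).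

Definition sigma_generator (x : brauer) : Prop :=
  exists i j (ij : i != j), x = sigma ij.

(* w is a product g_1 ... g_m of m >= 1 generators, bracketed to the left. *)
Inductive product_of_generators : brauer -> nat -> Prop :=
| product_generator g :
    sigma_generator g -> product_of_generators g 1
| product_mul w g m :
    product_of_generators w m -> sigma_generator g ->
    product_of_generators (brauer_mul w g) m.+1.

(* The graph of ls: ls(w) = m. *)
Definition is_ls (w : brauer) (m : nat) : Prop :=
  product_of_generators w m /\
  (forall k, product_of_generators w k -> m <= k).

End Brauer.

Arguments brauer_one {n}.

(* f is the maximal value of ls over the non-invertible elements; the first
   component includes that ls is defined at each of them. *)
Definition is_max_ls (n f : nat) : Prop :=
  (forall w : brauer n, ~~ invertible w -> exists2 m, is_ls w m & m <= f)
  /\ (exists2 w : brauer n, ~~ invertible w & is_ls w f).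

(* Main.v *)
(* Lower bound: let a strand of w be a block {x, y'}, read as x -> y.  Count the
   displaced strands (y <> x) plus the exchanged pairs (x -> y -> x).  This is
   0 on a generator, and multiplication by a generator redirects at most one
   surviving strand, which raises the count by at most 1.

   Upper bound: induct on the number N of points x with {x, x'} not a block,
   showing that floor(3N/2) - 2 factors suffice.  Given a lower hook {i', j'},
   any relabelling of w that exchanges i' with a further point is turned back
   into w by sigma_ij.  Exchanging i' with the partner of i fixes i and costs
   one factor; in the only case where this removes the last hooks, three
   factors fix two points. *)
Require Import Defs.
From mathcomp Require Import all_boot.
From mathcomp Require Import fingroup perm zify.
From Stdlib Require Import Classical.

Set Implicit Arguments.
Unset Strict Implicit.
Unset Printing Implicit Defensive.

(** * Elements as fixed-point-free involutions, and relabelling of points *)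

Section Mate.
Variable n : nat.
Implicit Types (v w x y : brauer n) (p q : point n) (i j : 'I_n).

(** The default [p] is never returned, as each point has a partner in its block. *)
Definition mate x p : point n :=
  odflt p [pick q | (q != p) && ([set p; q] \in blocks x)].

Lemma setU2_eq (T : finType) (p q s t : T) :
  [set p; q] = [set s; t] -> (p = s /\ q = t) \/ (p = t /\ q = s).
Proof.
move=> /setP E; have := E p; have := E q; have := E s; have := E t.
rewrite !inE !eqxx !orbT /= => /orP [] /eqP -> /orP [] /eqP -> /esym;
  by case/orP => /eqP E1 /esym /orP [] /eqP E2; subst; auto.
Qed.

Lemma mate_spec x :
  [/\ involutive (mate x), forall p, mate x p != p &
      blocks x = [set [set p; mate x p] | p : point n]].
Proof.
have [m mK [mN Ex]] := pairing_mate (blocksP x).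
suff E : mate x =1 m.
  split=> [p|p|]; rewrite ?E ?mK //.
  by rewrite Ex; apply: eq_imset => p; rewrite E.
move=> p; rewrite /mate; case: pickP => [q /andP [qp]|/(_ (m p))].
  by rewrite Ex => /imsetP [r _ /setU2_eq [[-> ->]|[-> ->]]] //=; rewrite mK.
by rewrite mN Ex => /negP []; apply: imset_f.
Qed.

Lemma mateK x : involutive (mate x). Proof. by case: (mate_spec x). Qed.
Lemma mateN x p : mate x p != p. Proof. by case: (mate_spec x). Qed.
Lemma mate_inj x : injective (mate x). Proof. exact: inv_inj (@mateK x). Qed.

Lemma mate_eq x p q : (mate x p == q) = (p == mate x q).
Proof. exact: can2_eq (@mateK x) (@mateK x) p q. Qed.

Lemma mate_block x p : [set p; mate x p] \in blocks x.
Proof. by case: (mate_spec x) => _ _ ->; apply: imset_f. Qed.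

Lemma block_mate x p q : [set p; q] \in blocks x -> mate x p = q.
Proof.
case: (mate_spec x) => _ _ -> /imsetP [r _ /setU2_eq [[-> ->]|[-> ->]]] //;
  apply: mateK.
Qed.

Lemma brauer_ext x y : mate x =1 mate y -> x = y.
Proof.
move=> E; apply: val_inj => /=.
case: (mate_spec x) => _ _ ->; case: (mate_spec y) => _ _ ->.
by apply: eq_imset => p; rewrite E.
Qed.

Lemma mate_of_involution (m : point n -> point n)
    (mK : involutive m) (mN : forall p, m p != p) :
  mate (Brauer (pairing_of_involution mK mN)) =1 m.
Proof. by move=> p; apply: block_mate; apply: imset_f. Qed.

(** Conjugation by [s] replaces each point [p] in the blocks of [x] by [s p]. *)
Definition relabel_fun (s : {perm point n}) x p := s (mate x (s^-1%g p)).

Lemma relabel_funK s x : involutive (relabel_fun s x).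
Proof. by move=> p; rewrite /relabel_fun permK mateK permKV. Qed.

Lemma relabel_funN s x p : relabel_fun s x p != p.
Proof. by rewrite /relabel_fun -{2}(permKV s p) (inj_eq perm_inj) mateN. Qed.

Definition relabel s x : brauer n :=
  Brauer (pairing_of_involution (@relabel_funK s x) (@relabel_funN s x)).

Lemma mate_relabel s x p : mate (relabel s x) p = s (mate x (s^-1%g p)).
Proof. exact: mate_of_involution. Qed.

Lemma mate_relabel_tperm p q x r :
  mate (relabel (tperm p q) x) r = tperm p q (mate x (tperm p q r)).
Proof. by rewrite mate_relabel tpermV. Qed.

Lemma mate_sigma i j (ij : i != j) p :
  mate (sigma ij) p = match p with
  | inl k => if k == i then inl j else if k == j then inl i else inr k
  | inr k => if k == i then inr j else if k == j then inr i else inl k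
  end.
Proof.
have up k : k != i -> k != j -> [set (inl k : point n); inr k] \in blocks (sigma ij).
  move=> ki kj; rewrite !inE; apply/orP; right; apply: imset_f.
  by rewrite !inE negb_or ki.
apply: block_mate; case: p => k;
  case: (eqVneq k i) => [->|ki]; try (by rewrite !inE eqxx ?orbT);
  case: (eqVneq k j) => [->|kj]; try (by rewrite setUC !inE eqxx ?orbT).
  exact: up.
by rewrite setUC up.
Qed.

(** * Right multiplication by a generator *)

Section MulSigma.
Variables (x : brauer n) (i j : 'I_n) (ij : i != j).

Let C := connect (cedge x (sigma ij)).

Let cedge_sym : connect_sym (cedge x (sigma ij)).
Proof. by apply: sym_connect_sym => u v; rewrite /cedge setUC. Qed.

Let left_edge p : C (of_left p) (of_left (mate x p)).
Proof.
apply: connect1; apply/orP; left; apply/imsetP.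
by exists [set p; mate x p]; rewrite ?mate_block // imsetU1 imset_set1.
Qed.

Let right_edge p : C (of_right p) (of_right (mate (sigma ij) p)).
Proof.
apply: connect1; apply/orP; right; apply/imsetP.
by exists [set p; mate (sigma ij) p]; rewrite ?mate_block // imsetU1 imset_set1.
Qed.

(** For [k] other than [i] and [j], the block {k, k'} of the generator leads from the outer point k'
    back to the point k' of [x]. *)
Let outer_left p : p != inr i -> p != inr j -> C (outer p) (of_left p).
Proof.
case: p => k //= ki kj; first exact: connect0.
have := right_edge (inr k); rewrite mate_sigma.
by rewrite ifN // ifN.
Qed.

Let mate_mul p q : p != q -> C (outer p) (outer q) ->
  mate (brauer_mul x (sigma ij)) p = q.
Proof. by move=> pq c; apply: block_mate; apply: mul_joined. Qed.

Lemma mate_mul_sigma_hook : mate (brauer_mul x (sigma ij)) (inr i) = inr j.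
Proof.
apply: mate_mul => //.
by have := right_edge (inr i); rewrite mate_sigma eqxx.
Qed.

Lemma mate_mul_sigma_id p :
  p != inr i -> p != inr j -> mate x p != inr i -> mate x p != inr j ->
  mate (brauer_mul x (sigma ij)) p = mate x p.
Proof.
move=> pi pj mi mj; apply: mate_mul; first by rewrite eq_sym mateN.
apply: connect_trans (outer_left pi pj) _.
apply: connect_trans (left_edge p) _.
by rewrite cedge_sym; apply: outer_left.
Qed.

(** The upper hook {i, j} of the generator links the blocks of [x] at i' and j'; the hypothesis
    excludes a closed loop. *)
Lemma mate_mul_sigma_join : mate x (inr i) != inr j ->
  mate (brauer_mul x (sigma ij)) (mate x (inr i)) = mate x (inr j).
Proof.
move=> mij; have mji : mate x (inr j) != inr i by rewrite mate_eq eq_sym.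
apply: mate_mul; first by rewrite (inj_eq (@mate_inj x)).
apply: connect_trans (outer_left (mateN _ _) mij) _.
rewrite cedge_sym; apply: connect_trans (outer_left mji (mateN _ _)) _.
rewrite cedge_sym; have := left_edge (inr i).
rewrite [C _ _]cedge_sym => /connect_trans; apply.
apply: connect_trans (left_edge (inr j)).
by have := right_edge (inl i); rewrite mate_sigma eqxx.
Qed.

End MulSigma.
End Mate.

(** * Lower bound: a potential on strands *)

Section LowerBound.
Variable n : nat.
Implicit Types (f g : 'I_n -> option 'I_n) (v : brauer n).

Definition displaced f : {set 'I_n} :=
  [set x | if f x is Some y then y != x else false].

(** The test [x < y] counts each pair once, at its smaller point. *)
Definition exchanged f : {set 'I_n} :=
  [set x | if f x is Some y then (x < y) && (f y == Some x) else false].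

Definition partial_inj f := forall x y z, f x = Some z -> f y = Some z -> x = y.

(* If {x0, k} is newly exchanged, then k -> x0 already held before the change,
   so by injectivity x0 was already displaced: the counts never grow together. *)
Lemma potential_step f g x0 : partial_inj f -> partial_inj g ->
  (forall x, x != x0 -> g x = f x \/ g x = None) ->
  (g x0 = None \/ f x0 <> None) ->
  #|displaced g| + #|exchanged g| <= (#|displaced f| + #|exchanged f|).+1.
Proof.
move=> fI gI fg g0.
have dS : displaced g \subset x0 |: displaced f.
  apply/subsetP => x; rewrite !inE; case: eqP => //= /eqP xx0.
  by case: (fg x xx0) => ->.
have [eS|] := boolP (exchanged g \subset exchanged f).
  have := subset_leq_card eS; have := subset_leq_card dS.
  by rewrite cardsU1; case: (x0 \notin _) => /=; lia.
case/subsetPn => z; rewrite !inE.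
case gz: (g z) => [y|] // /andP [zy /eqP gy] fz.
(* Away from [x0] the defined values of [g] are those of [f], so a new exchanged pair contains
   [x0]. *)
have fpart : exists2 k, k != x0 & g x0 = Some k /\ g k = Some x0.
  case: (eqVneq z x0) => [zx0|zx0].
    by exists y; rewrite -zx0 //; apply/eqP => yz; move: zy; rewrite yz ltnn.
  case: (eqVneq y x0) => [yx0|yx0]; first by exists z => //; rewrite -yx0.
  case: (fg z zx0) (fg y yx0) => [E1|]; last by rewrite gz.
  case=> [E2|]; last by rewrite gy.
  by move: fz; rewrite -E1 gz zy -E2 gy eqxx.
have [k kx0 [gx0 gk]] := fpart.
have fk : f k = Some x0 by case: (fg k kx0) gk => ->.
have x0d : x0 \in displaced f.
  rewrite inE; case fx0: (f x0) g0 => [y'|]; last by rewrite gx0; case.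
  move=> _; apply: contraNneq kx0 => E; rewrite E in fx0.
  by apply/eqP; apply: fI fk fx0.
have dS' : displaced g \subset displaced f.
  by apply: subset_trans dS _; rewrite subUset sub1set x0d subxx.
(* The pair {x0, k} is the only new one, recorded at its smaller point. *)
have eS : exchanged g \subset (if x0 < k then x0 else k) |: exchanged f.
  apply/subsetP => x; rewrite !inE; case gx: (g x) => [u|] // /andP [xu /eqP gu].
  case: (eqVneq x x0) => [E|xx0].
    by move: gx xu; rewrite E gx0 => -[->] ->; rewrite eqxx.
  case: (eqVneq u x0) => [E|ux0].
    have xk : x = k by apply: gI gk; rewrite gx E.
    by move: xu; rewrite E xk => H; rewrite ltnNge (ltnW H) /= eqxx.
  case: (fg x xx0) (fg u ux0) => [<-|]; last by rewrite gx.
  case=> [E2|]; last by rewrite gu.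
  by rewrite gx xu -E2 gu eqxx orbT.
have := subset_leq_card eS; have := subset_leq_card dS'.
by rewrite cardsU1; case: (_ \notin _) => /=; lia.
Qed.

Definition strand v (x : 'I_n) : option 'I_n :=
  if mate v (inl x) is inr y then Some y else None.

Lemma strandE v x y : strand v x = Some y <-> mate v (inl x) = inr y.
Proof. by rewrite /strand; case: (mate v (inl x)) => z; split=> // -[->]. Qed.

Lemma strand_inj v : partial_inj (strand v).
Proof.
move=> x y z /strandE E1 /strandE E2.
by have : inl x = inl y :> point n; [apply: (@mate_inj n v); rewrite E1 E2|case].
Qed.

Definition potential v := #|displaced (strand v)| + #|exchanged (strand v)|.

Lemma strand_mul_id v i j (ij : i != j) x :
  mate v (inl x) != inr i -> mate v (inl x) != inr j ->
  strand (brauer_mul v (sigma ij)) x = strand v x.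
Proof. by move=> mi mj; rewrite /strand mate_mul_sigma_id. Qed.

(** Take for [x0] the origin of the strand ending at i', or failing that at j'. If both strands
    exist, they merge into an upper hook and vanish. If neither exists, no strand changes and the
    choice [x0 = i] is arbitrary. *)
Lemma potential_mul v i j (ij : i != j) :
  potential (brauer_mul v (sigma ij)) <= (potential v).+1.
Proof.
have step x0 := potential_step (x0 := x0) (@strand_inj v)
  (@strand_inj (brauer_mul v (sigma ij))).
case mi: (mate v (inr i)) => [x|k].
  have mx : mate v (inl x) = inr i by rewrite -mi mateK.
  apply: (step x); last by right; rewrite /strand mx.
  move=> y yx; case: (eqVneq (mate v (inl y)) (inr j)) => my.
    right; rewrite /strand.
    have mj : mate v (inr j) = inl y by rewrite -my mateK.
    have := mate_mul_sigma_join ij (x := v); rewrite mi mj => /(_ isT) E.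
    by rewrite -E mateK.
  left; apply: strand_mul_id => //; rewrite mate_eq mi.
  by apply: contraNneq yx => -[->].
case mj: (mate v (inr j)) => [x|l].
  have mx : mate v (inl x) = inr j by rewrite -mj mateK.
  apply: (step x); last by right; rewrite /strand mx.
  move=> y yx; left; apply: strand_mul_id; rewrite mate_eq ?mi ?mj //.
apply: (step i).
  by move=> y _; left; apply: strand_mul_id; rewrite mate_eq ?mi ?mj.
rewrite strand_mul_id ?mate_eq ?mi ?mj //.
by case: (strand v i) => [a|]; [right|left].
Qed.

Lemma potential_sigma i j (ij : i != j) : potential (sigma ij) = 0.
Proof.
have sE x : strand (sigma ij) x = Some x \/ strand (sigma ij) x = None.
  by rewrite /strand mate_sigma; case: ifP => _; [|case: ifP => _]; auto.
rewrite /potential; apply/eqP; rewrite addn_eq0 !cards_eq0.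
apply/andP; split; apply/eqP/setP => x; rewrite !inE;
  by case: (sE x) => -> //; rewrite ?eqxx // ltnn.
Qed.

Lemma potential_product v k :
  product_of_generators v k -> potential v < k.
Proof.
elim=> [g [i [j [ij ->]]]|w g m _ IH [i [j [ij ->]]]].
  by rewrite potential_sigma.
exact: leq_ltn_trans (potential_mul _ _) _.
Qed.

End LowerBound.

(** * Upper bound by straightening *)

Section UpperBound.
Variable n : nat.
Implicit Types (w : brauer n) (p b : point n) (i j k x y : 'I_n).

Definition lower_hook w := [exists i, exists j, mate w (inr i) == inr j].

Lemma lower_hookI w i j : mate w (inr i) = inr j -> lower_hook w.
Proof. by move=> E; apply/existsP; exists i; apply/existsP; exists j; apply/eqP. Qed.

(* Without lower hooks the n lower points are matched injectively with upper
   ones, which exhausts these. *)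
Lemma upper_hook_lower w i j : mate w (inl i) = inl j -> lower_hook w.
Proof.
move=> E; apply: contraT => noL.
have /fin_all_exists [g gP] k : exists l, mate w (inr k) = inl l.
  case mk: (mate w (inr k)) => [l|l]; first by exists l.
  by case: (negP noL); apply: (lower_hookI mk).
have gI : injective g.
  move=> k l gkl; have : inr k = inr l :> point n; last by case.
  by apply: (@mate_inj n w); rewrite !gP gkl.
have := gP (invF gI i); rewrite f_invF => /(congr1 (mate w)).
by rewrite mateK E.
Qed.

(** Some block is a hook, and an upper hook forces a lower one. *)
Lemma noninvertible_lower_hook w : ~~ invertible w -> lower_hook w.
Proof.
move=> wN; apply: contraT => noL; case/negP: wN.
apply/invertibleP => B; case: (mate_spec w) => _ _ -> /imsetP [[i|i] _ ->].
  case E: (mate w (inl i)) => [j|j]; last by exists i, j.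
  by case: (negP noL); apply: (upper_hook_lower E).
case E: (mate w (inr i)) => [j|j]; first by exists j, i; rewrite setUC.
by case: (negP noL); apply: (lower_hookI E).
Qed.

Lemma lower_hook_neq w i j : mate w (inr i) = inr j -> i != j.
Proof. by move=> E; have := mateN w (inr i); rewrite E; apply: contraNneq => ->. Qed.

(** With [a] the partner of [b] in [w], the relabelling has the blocks {a, i'} and {b, j'}; the
    generator links [a] to [b] again and restores {i', j'}. *)
Lemma relabel_mul_sigma w i j (ij : i != j) b :
  mate w (inr i) = inr j -> b != inr i -> b != inr j ->
  brauer_mul (relabel (tperm b (inr i)) w) (sigma ij) = w.
Proof.
move=> hij bi bj; have hji : mate w (inr j) = inr i by rewrite -hij mateK.
set w' := relabel _ w; set a := mate w b.
have ai : a != inr i by rewrite mate_eq hij.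
have aj : a != inr j by rewrite mate_eq hji.
have ba : b != a by rewrite eq_sym mateN.
have iNj : inr i != inr j :> point n by apply: contraNneq ij => -[->].
have mi : mate w' (inr i) = a.
  by rewrite mate_relabel_tperm tpermR tpermD // eq_sym.
have mj : mate w' (inr j) = b.
  by rewrite mate_relabel_tperm (tpermD bj iNj) hji tpermR.
have mab : mate (brauer_mul w' (sigma ij)) a = b.
  by have := mate_mul_sigma_join ij (x := w'); rewrite mi mj; apply.
have mh := mate_mul_sigma_hook w' ij.
apply: brauer_ext => p.
case: (eqVneq p (inr i)) => [->|pi]; first by rewrite mh hij.
case: (eqVneq p (inr j)) => [->|pj]; first by rewrite hji -mh mateK.
case: (eqVneq p a) => [->|pa]; first by rewrite mab /a mateK.
case: (eqVneq p b) => [->|pb]; first by rewrite -{1}mab mateK.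
have E : mate w' p = mate w p.
  rewrite mate_relabel_tperm (@tpermD _ _ _ p) 1?eq_sym // tpermD //.
    by rewrite eq_sym mate_eq.
  by rewrite eq_sym mate_eq hij.
by rewrite mate_mul_sigma_id ?E // mate_eq ?hij ?hji.
Qed.

Definition moved w : {set 'I_n} := [set x | mate w (inl x) != inr x].

Definition straighten i w := relabel (tperm (mate w (inl i)) (inr i)) w.

Section Straighten.
Variables (w : brauer n) (i j : 'I_n).
Hypothesis hij : mate w (inr i) = inr j.

Let ij : i != j. Proof. exact: lower_hook_neq hij. Qed.
Let hji : mate w (inr j) = inr i. Proof. by rewrite -hij mateK. Qed.
Let bi : mate w (inl i) != inr i. Proof. by rewrite mate_eq hij. Qed.
Let bj : mate w (inl i) != inr j. Proof. by rewrite mate_eq hji. Qed.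

Lemma straighten_mul : brauer_mul (straighten i w) (sigma ij) = w.
Proof. exact: relabel_mul_sigma. Qed.

Lemma mate_straighten_id p : p != inl i -> p != mate w (inl i) ->
  p != inr i -> p != inr j -> mate (straighten i w) p = mate w p.
Proof.
move=> pi pb pi' pj'; rewrite mate_relabel_tperm (@tpermD _ _ _ p) 1?eq_sym //.
rewrite tpermD // eq_sym ?(inj_eq (@mate_inj n w)) //.
by rewrite mate_eq hij.
Qed.

Lemma mate_straighten : mate (straighten i w) (inl i) = inr i.
Proof.
by rewrite mate_relabel_tperm (@tpermD _ _ _ (inl i)) ?mateN // tpermL.
Qed.

(** If the partner of [i] is a lower point, it forms a new lower hook with j', so straightening can
    go on. *)
Lemma mate_straighten_hook : mate (straighten i w) (inr j) = mate w (inl i).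
Proof.
by rewrite mate_relabel_tperm (@tpermD _ _ _ (inr j)) ?hji ?tpermR //
  -?hij 1?eq_sym ?mateN.
Qed.

(** Only the block {i', j'} and that of [i] are changed, and neither has the form {x, x'}. *)
Lemma moved_straighten : moved (straighten i w) \subset moved w :\ i.
Proof.
apply/subsetP => x; rewrite !inE => H; apply/andP; split.
  by apply: contraNneq H => ->; rewrite mate_straighten.
apply: contraNneq H => mx.
have xi : x != i by apply: contraNneq bi => <-; rewrite mx.
have xj : x != j.
  by apply/eqP => E; move: hji; rewrite -E -mx mateK.
by rewrite mate_straighten_id ?mx // eq_sym mate_eq mx.
Qed.

Lemma card_moved_straighten : #|moved (straighten i w)| < #|moved w|.
Proof.
have iM : i \in moved w by rewrite inE.
rewrite (cardsD1 i (moved w)) iM ltnS.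
exact: subset_leq_card moved_straighten.
Qed.

End Straighten.

Lemma product_mul_sigma w i j (ij : i != j) m :
  product_of_generators w m -> product_of_generators (brauer_mul w (sigma ij)) m.+1.
Proof. by move=> wm; apply: product_mul => //; exists i, j, ij. Qed.

Lemma tperm_inr (x y z : 'I_n) :
  exists t, tperm (inr x : point n) (inr y) (inr z) = inr t.
Proof. by case: tpermP => [_|_|_ _]; [exists y|exists x|exists z]. Qed.

(* If no straightening leaves a lower hook, then w has a single pair of hooks,
   {i,j} and {i',j'}.  Either w is a generator, or a strand a -> b', a != b,
   exists; three factors then fix b and d, where b -> d'. *)
Lemma product_bound w : lower_hook w ->
  exists2 k, product_of_generators w k & k + 2 <= (3 * #|moved w|) %/ 2.
Proof.
have [m] := ubnP #|moved w|; elim: m w => // m IH w wm.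
have [/existsP [i /existsP [j /andP [/eqP hij sL]]] _|] :=
  boolP [exists i, exists j,
           (mate w (inr i) == inr j) && lower_hook (straighten i w)].
  have lt := card_moved_straighten hij.
  have [|k kP kB] := IH (straighten i w) _ sL; first by apply: leq_trans lt _.
  (* One fewer moved point lowers the bound by at least 1, which pays for one factor. *)
  exists k.+1; last by lia.
  rewrite -(straighten_mul hij); exact: product_mul_sigma.
move=> noS /existsP [i /existsP [j /eqP hij]].
have {}noS k l : mate w (inr k) = inr l -> ~~ lower_hook (straighten k w).
  move=> E; apply: contra noS => L.
  by apply/existsP; exists k; apply/existsP; exists l; rewrite E eqxx.
have hji : mate w (inr j) = inr i by rewrite -hij mateK.
have ij := lower_hook_neq hij.
(* Otherwise straightening at [k] would pair l' with y', a lower hook. *)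
have up k l : mate w (inr k) = inr l -> exists u, mate w (inl k) = inl u.
  move=> E; case mk: (mate w (inl k)) => [u|y]; first by exists u.
  case/negP: (noS _ _ E); apply: (@lower_hookI _ l y).
  by rewrite (mate_straighten_hook E).
(* An upper hook avoiding [k] would survive straightening at [k] and force a lower hook. *)
have keep k u x y : mate w (inr k) = inr i \/ mate w (inr k) = inr j ->
    mate w (inl k) = inl u -> x != k -> x != u -> mate w (inl x) <> inl y.
  move=> hk Eu xk xu Ey.
  have [l hkl] : exists l, mate w (inr k) = inr l by case: hk; eauto.
  case/negP: (noS _ _ hkl); apply: (@upper_hook_lower _ x y).
  by rewrite (mate_straighten_id hkl) // Eu.
have [u iu] := up _ _ hij; have [v jv] := up _ _ hji.
have iuj : mate w (inl i) = inl j.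
  rewrite iu; case: (eqVneq j u) => [-> //|ju].
  by case: (keep i u j v); auto; rewrite eq_sym.
have strandP x : x != i -> x != j -> exists y, mate w (inl x) = inr y.
  move=> xi xj; case E: (mate w (inl x)) => [y|y]; last by exists y.
  by case: (keep i j x y); auto.
have iM : i \in moved w by rewrite inE iuj.
have jM : j \in moved w by rewrite inE jv.
have [sM|] := boolP (moved w \subset [set i; j]).
  have card2 : 1 < #|moved w|.
    apply: leq_trans (subset_leq_card (A := [set i; j]) _).
      by rewrite cards2 ij.
    by rewrite subUset !sub1set iM.
  (* The base case is tight: 1 + 2 = 3 * 2 / 2. *)
  exists 1; last by lia.
  suff -> : w = sigma ij by apply: product_generator; exists i, j, ij.
  have fixP x : x != i -> x != j -> mate w (inl x) = inr x.
    move=> xi xj; apply/eqP; have := subsetP sM x; rewrite !inE.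
    by rewrite (negbTE xi) (negbTE xj); case: eqP => // _ /(_ isT).
  apply: brauer_ext => -[x|x]; rewrite mate_sigma;
    case: (eqVneq x i) => [->|xi] //; case: (eqVneq x j) => [->|xj] //.
  - by rewrite -iuj mateK.
  - exact: fixP.
  - by rewrite -(fixP x) // mateK.
case/subsetPn => a; rewrite !inE negb_or => ma /andP [ai aj].
have [b ab] := strandP a ai aj.
have bN c : mate w (inl c) <> inr i /\ mate w (inl c) <> inr j.
  by split=> E; [move: hij|move: hji]; rewrite -E mateK.
have ba : b != a by apply: contraNneq ma => E; rewrite ab E.
have bi : b != i by apply/eqP => E; case: (bN a); rewrite ab E.
have bj : b != j by apply/eqP => E; case: (bN a); rewrite ab E.
have [d bd] := strandP b bi bj.
have di : d != i by apply/eqP => E; case: (bN b); rewrite bd E.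
have dj : d != j by apply/eqP => E; case: (bN b); rewrite bd E.
have db : d != b.
  apply: contraNneq ba => E; have : inl a = inl b :> point n; last by case=> ->.
  by apply: (@mate_inj n w); rewrite ab bd E.
have [e de] := strandP d di dj.
(* [w1] moves the hook from {i', j'} to {b', j'}. Straightening at [b], which is joined to d', moves
   it to {d', j'}; straightening at [d] leaves another lower hook, since the partner of [d] stays
   lower. *)
pose w1 := relabel (tperm (inr b) (inr i)) w.
have w1E : brauer_mul w1 (sigma ij) = w by apply: relabel_mul_sigma.
have hbj : mate w1 (inr b) = inr j.
  by rewrite mate_relabel_tperm tpermL hij tpermD.
have mb : mate w1 (inl b) = inr d.
  by rewrite mate_relabel_tperm [tperm _ _ (inl b)]tpermD // bd tpermD // eq_sym.
pose w2 := straighten b w1.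
have hdj : mate w2 (inr d) = inr j.
  by rewrite -mb -(mate_straighten_hook hbj) mateK.
pose w3 := straighten d w2.
have L3 : lower_hook w3.
  have [e1 E1] := tperm_inr b i e; have [e2 E2] := tperm_inr d b e1.
  apply: (@lower_hookI _ j e2); rewrite (mate_straighten_hook hdj).
  rewrite mate_relabel_tperm mb [tperm _ _ (inl d)]tpermD // mate_relabel_tperm.
  by rewrite [tperm _ _ (inl d)]tpermD // de E1 E2.
(* Neither b' nor i' lies in a block of the form {x, x'}, so exchanging them destroys none. *)
have M1 : moved w1 \subset moved w.
  apply/subsetP => x; rewrite !inE; apply: contraNneq => mx.
  rewrite mate_relabel_tperm [tperm _ _ (inl x)]tpermD // mx tpermD //.
    by apply: contraNneq db => -[E]; move: bd; rewrite E mx => -[->].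
  by apply/eqP => -[E]; case: (bN x); rewrite mx E.
have lt : #|moved w3| + 2 <= #|moved w|.
  apply: leq_trans (subset_leq_card M1); rewrite addn2.
  exact: leq_ltn_trans (card_moved_straighten hdj) (card_moved_straighten hbj).
have [|k kP kB] := IH w3 _ L3; first by move: lt wm; clear; lia.
(* Two fewer moved points lower the bound by 3, the cost of the three factors. *)
exists k.+3; last by move: lt kB; clear; lia.
rewrite -w1E; apply: product_mul_sigma.
rewrite -(straighten_mul hbj); apply: product_mul_sigma.
rewrite -/w2 -(straighten_mul hdj); exact: product_mul_sigma.
Qed.

End UpperBound.

(** Descent on [k]: excluded middle decides whether a shorter product exists. *)
Lemma is_ls_exists n (w : brauer n) k : product_of_generators w k ->
  exists2 m, is_ls w m & m <= k.
Proof.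
elim/ltn_ind: k => k IH wk.
case: (classic (exists2 l, product_of_generators w l & l < k)) => [[l wl lk]|no].
  by have [m mP ml] := IH l lk wl; exists m => //; apply: leq_trans ml (ltnW lk).
exists k => //; split=> // l wl; rewrite leqNgt; apply/negP => lk.
by apply: no; exists l.
Qed.

Lemma leq_card_inj (T : finType) m (h : 'I_m -> T) (S : {set T}) :
  injective h -> (forall i, h i \in S) -> m <= #|S|.
Proof.
move=> hI hS; rewrite -[m in m <= _]card_ord -cardsT -(card_imset _ hI).
by apply: subset_leq_card; apply/subsetP => _ /imsetP [i _ ->].
Qed.

(** * An element attaining the bound *)

Section Witness.
Variable n : nat.
Implicit Types x : 'I_n.

(** The involution swapping 2m and 2m+1, counted from 0; for odd [n] the last position is fixed. *)
Definition neighbour_nat (x : nat) : nat :=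
  if odd x then x.-1 else if x.+1 < n then x.+1 else x.

Lemma neighbour_ltn x : neighbour_nat x < n.
Proof. by rewrite /neighbour_nat; have := ltn_ord x; do ![case: ifP]; lia. Qed.

Definition neighbour x : 'I_n := Ordinal (neighbour_ltn x).

Lemma neighbourK : involutive neighbour.
Proof.
move=> x; apply: val_inj => /=; rewrite /neighbour_nat; have := ltn_ord x.
by do ![case: ifP]; lia.
Qed.

Definition move_lower (p : point n) : point n :=
  match p with inl x => inl x | inr x => inr (neighbour x) end.

Lemma move_lowerK : involutive move_lower.
Proof. by move=> [x|x] //=; rewrite neighbourK. Qed.

Hypothesis hn : 2 <= n.

Let i0 : 'I_n := Ordinal (ltac:(lia) : n - 2 < n).
Let i1 : 'I_n := Ordinal (ltac:(lia) : n - 1 < n).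
Let i01 : i0 != i1. Proof. by rewrite -val_eqE /=; lia. Qed.

(* The hooks sit at the last two positions.  For even n the other strands form
   (n-2)/2 exchanged pairs; for odd n all but one do, and that one is still
   displaced, ending at position n-2. *)
Definition witness : brauer n :=
  relabel (perm (inv_inj move_lowerK)) (sigma i01).

Lemma mate_witness p :
  mate witness p = move_lower (mate (sigma i01) (move_lower p)).
Proof.
rewrite mate_relabel permE; congr (move_lower (mate _ _)).
apply: (@perm_inj _ (perm (inv_inj move_lowerK))).
by rewrite permKV permE move_lowerK.
Qed.

Lemma lower_hook_witness : lower_hook witness.
Proof.
apply: (@lower_hookI _ _ (neighbour i0) (neighbour i1)).
by rewrite mate_witness /= neighbourK mate_sigma eqxx.
Qed.

Lemma strand_witness x : x < n - 2 -> strand witness x = Some (neighbour x).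
Proof.
move=> xn; apply/strandE; rewrite mate_witness /= mate_sigma.
by rewrite !ifN // -val_eqE /=; lia.
Qed.

(** All n-2 strands are displaced, and each [k] below floor((n-2)/2) gives the exchanged pair {2k,
    2k+1}. *)
Lemma potential_witness : n - 2 + (n - 2) %/ 2 <= potential witness.
Proof.
apply: leq_add.
  apply: (leq_card_inj (h := widen_ord (leq_subr 2 n))) => [x y /(congr1 val) E|x].
    exact: val_inj.
  rewrite inE strand_witness //= -val_eqE /= /neighbour_nat; have := ltn_ord x.
  by case: ifP; [|case: ifP]; lia.
have lt (k : 'I_((n - 2) %/ 2)) : k.*2 < n by have := ltn_ord k; lia.
apply: (leq_card_inj (h := fun k => Ordinal (lt k))) => [k l /(congr1 val) /= E|k].
  by apply: val_inj => /=; lia.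
have kn : k.*2.+1 < n - 2 by have := ltn_ord k; lia.
have E : neighbour (Ordinal (lt k)) = k.*2.+1 :> nat.
  by rewrite /= /neighbour_nat odd_double ifT //; lia.
have sk : strand witness (Ordinal (lt k)) = Some (neighbour (Ordinal (lt k))).
  by apply: strand_witness => /=; lia.
by rewrite inE sk strand_witness E // neighbourK eqxx andbT /=.
Qed.

End Witness.

(** * The two bounds combined *)

Theorem theorem18 (n : nat) (hn : 2 <= n) : is_max_ls n ((3 * n) %/ 2 - 2).
Proof.
have upper (w : brauer n) : lower_hook w ->
    exists2 m, is_ls w m & m <= (3 * n) %/ 2 - 2.
  move=> /product_bound [k /is_ls_exists [m mP mk] kB]; exists m => //.
  (* At most [n] points are moved. *)
  by have := max_card (moved w); rewrite card_ord; lia.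
split=> [w /noninvertible_lower_hook|]; first exact: upper.
exists (witness hn).
  apply/negP => /invertibleP inv.
  have /existsP [i /existsP [j /eqP E]] := lower_hook_witness hn.
  have := mate_block (witness hn) (inr i); rewrite E => /inv [k [l]].
  by case/setU2_eq => -[].
have [m mP mB] := upper _ (lower_hook_witness hn).
suff -> : (3 * n) %/ 2 - 2 = m by [].
(* The length exceeds the potential, and n - 2 + floor((n-2)/2) + 1 = floor(3n/2) - 2. *)
have := potential_product mP.1; have := potential_witness hn; lia.
Qed.
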